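(* Let $G$ be a connected edge-transitive graph that is not a star. Then every induced path of length at most $3$ in $G$ closes to an induced cycle. Moreover, for every integer $\ell\geq 4$, there exists a connected edge-transitive graph containing an induced path of length $\ell$ not contained in any induced cycle.
   Context: All graphs are finite, simple and undirected. A star is a complete bipartite graph $K_{1,n}$ for some $n\ge 0$. A graph is edge-transitive if for every two edges $e,f$ there is an automorphism mapping $e$ to $f$. A path of length $\ell$ in $G$ is a sequence $(x_0,\dots,x_\ell)$ of pairwise distinct vertices with $x_i x_{i+1}\in E(G)$ for $0\le i\le \ell-1$ (length $0$ means a single vertex). A cycle is a sequence $(x_0,\dots,x_{\ell-1},x_\ell=x_0)$ with $\ell\ge 3$, $x_0,\dots,x_{\ell-1}$ pairwise distinct and consecutive vertices adjacent. Paths and cycles are identified with the subgraphs formed by their vertices and edges; they are induced if this subgraph is an induced subgraph of $G$. An induced path $P$ closes to an induced cycle if there is an induced cycle $C$ in $G$ such that $P$ is an induced subgraph of $C$. *)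

(* Defs.v *)
From mathcomp Require Import all_boot perm.
Set Implicit Arguments.
Unset Strict Implicit.
Unset Printing Implicit Defensive.

Record sgraph := SGraph {
  vertex :> finType;
  adj : rel vertex;
  adj_sym : symmetric adj;
  adj_irrefl : irreflexive adj }.

Definition edges (G : sgraph) : {set {set G}} :=
  [set [set u.1; u.2] | u : G * G & adj u.1 u.2].

Definition connected (G : sgraph) : Prop :=
  0 < #|G| /\ forall x y : G, connect (@adj G) x y.

Definition isomorphic (G H : sgraph) : Prop :=
  exists2 f : G -> H, bijective f & {mono f : x y / adj x y}.

Definition bip_adj (m n : nat) (x y : 'I_m + 'I_n) : bool :=
  match x, y with
  | inl _, inr _ | inr _, inl _ => true
  | _, _ => false
  end.

Lemma bip_adj_sym m n : symmetric (@bip_adj m n).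
Proof. by case=> [x|x] [y|y]. Qed.

Lemma bip_adj_irrefl m n : irreflexive (@bip_adj m n).
Proof. by case. Qed.

Definition complete_bipartite (m n : nat) : sgraph :=
  SGraph (@bip_adj_sym m n) (@bip_adj_irrefl m n).

Definition is_star (G : sgraph) : Prop :=
  exists n : nat, isomorphic G (complete_bipartite 1 n).

Definition is_automorphism (G : sgraph) (s : {perm G}) : Prop :=
  {mono s : x y / adj x y}.

Definition edge_transitive (G : sgraph) : Prop :=
  forall e f : {set G}, e \in edges G -> f \in edges G ->
    exists2 s : {perm G}, is_automorphism s & s @: e = f.

(* A vertex set together with a set of edges, each edge being a two-element
   vertex set. That the edges lie in [edges G] and have their ends in the
   vertex set is not imposed here; it holds for the subgraphs of paths and
   cycles below. *)
Record subgraph (G : sgraph) := Subgraph {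
  sverts : {set G};
  sedges : {set {set G}} }.

Definition whole (G : sgraph) : subgraph G := Subgraph [set: G] (edges G).

Definition is_subgraph (G : sgraph) (H K : subgraph G) : Prop :=
  sverts H \subset sverts K /\ sedges H \subset sedges K.

Definition is_induced_subgraph (G : sgraph) (H K : subgraph G) : Prop :=
  sverts H \subset sverts K /\
  sedges H = [set e in sedges K | e \subset sverts H].

(* [p] is [:: x_0; ...; x_l]: a path of length l has l + 1 vertices. *)
Definition is_path (G : sgraph) (l : nat) (p : seq G) : Prop :=
  [/\ size p = l.+1, uniq p & sorted (@adj G) p].

(* [c] is [:: x_0; ...; x_(l-1)], the final x_l = x_0 being omitted; [cycle]
   includes the adjacency of x_(l-1) and x_0. *)
Definition is_cycle (G : sgraph) (c : seq G) : Prop :=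
  [/\ 3 <= size c, uniq c & cycle (@adj G) c].

(* [zip p (behead p)] lists the pairs (x_i, x_(i+1)) of consecutive vertices;
   [zip c (rot 1 c)] does so cyclically. *)
Definition path_subgraph (G : sgraph) (p : seq G) : subgraph G :=
  Subgraph [set x in p] [set [set u.1; u.2] | u in zip p (behead p)].

Definition cycle_subgraph (G : sgraph) (c : seq G) : subgraph G :=
  Subgraph [set x in c] [set [set u.1; u.2] | u in zip c (rot 1 c)].

Definition is_induced_path (G : sgraph) (l : nat) (p : seq G) : Prop :=
  is_path l p /\ is_induced_subgraph (path_subgraph p) (whole G).

Definition is_induced_cycle (G : sgraph) (c : seq G) : Prop :=
  is_cycle c /\ is_induced_subgraph (cycle_subgraph c) (whole G).

Definition closes_to_induced_cycle (G : sgraph) (p : seq G) : Prop :=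
  exists2 c : seq G, is_induced_cycle c &
    is_induced_subgraph (path_subgraph p) (cycle_subgraph c).

(* Main.v *)
Require Import Defs.
From mathcomp Require Import all_boot perm action primitive_action alt.
From mathcomp Require Import ssralg finalg zmodp zify.
Set Implicit Arguments.
Unset Strict Implicit.
Unset Printing Implicit Defensive.

(** An induced path [x0 x1 x2 x3] closes to an induced cycle as soon as some
    component of [G - N[x1 x2]] is adjacent to both ends. Otherwise, for an end
    [x], let [m(x)] be the largest size of a component of [G - N[x1 x2]]
    adjacent to [x]. The components with more than [m(x3)] vertices avoid the
    neighbours of [x3], hence survive in [G - N[x2 x3]], where moreover [x0]
    lies in a component with more than [m(x0)] vertices. If [m(x3) <= m(x0)],
    then strictly more vertices lie in components larger than [m(x3)] for the
    edge [x2 x3] than for [x1 x2], against edge-transitivity. So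
    [m(x0) < m(x3)], and reversing the path gives the opposite inequality. A
    shorter induced path either closes or extends by one vertex, since all
    edges of [G] have the same degree sum.

    Conversely, an induced path [x0 x1 ...] lies in no induced cycle if every
    neighbour of [x0] other than [x1] is adjacent to an interior vertex of the
    path. For length 4 this happens for [0 1 2 6 7] in the Paley graph on 13
    vertices; for length at least 5, in the incidence graph of the points and
    the 3-subsets of a large enough set, for a path from a block whose two
    other points lie in later blocks of the path. *)

(** * Induced paths and cycles *)

Lemma set2_inj (T : finType) (x y u v : T) : [set x; y] = [set u; v] ->
  (x, y) = (u, v) \/ (x, y) = (v, u).
Proof.
move=> exy.
have: x \in [set u; v] by rewrite -exy set21.
have: y \in [set u; v] by rewrite -exy set22.
have: u \in [set x; y] by rewrite exy set21.
have: v \in [set x; y] by rewrite exy set22.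
rewrite !inE.
by do 4![move=> /orP[] /eqP ?]; subst; auto.
Qed.

Section Sequences.

Variable T : eqType.
Implicit Types (x y : T) (p c : seq T).

Lemma mem_zip_beheadP x0 p x y :
  reflect (exists2 i, i.+1 < size p & (x, y) = (nth x0 p i, nth x0 p i.+1))
          ((x, y) \in zip p (behead p)).
Proof.
have sz : size (zip p (behead p)) = (size p).-1.
  by rewrite size_zip size_behead; apply/minn_idPr/leq_pred.
have nthE i : i.+1 < size p ->
    nth (x0, x0) (zip p (behead p)) i = (nth x0 p i, nth x0 p i.+1).
  by move=> ip; rewrite nth_zip_cond nth_behead sz ifT //; case: (size p) ip.
apply: (iffP (nthP (x0, x0))) => [[i] | [i ip xyE]].
  rewrite sz => ip <-; have {}ip : i.+1 < size p by case: (size p) ip.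
  by exists i; rewrite ?nthE.
by exists i; rewrite ?nthE // sz; case: (size p) ip.
Qed.

Lemma next_cons_nth x c i : uniq (x :: c) -> i <= size c ->
  next (x :: c) (nth x (x :: c) i) = nth x c i.
Proof. by move=> uxc ic; rewrite next_nth mem_nth // index_uniq. Qed.

Lemma zip_rot1 c : uniq c -> zip c (rot 1 c) = [seq (x, next c x) | x <- c].
Proof.
case: c => // x c uxc; rewrite rot1_cons.
have sz : size (x :: c) = size (rcons c x) by rewrite size_rcons.
apply: (@eq_from_nth _ (x, x)) => [|i].
  by rewrite size_zip -sz minnn size_map.
rewrite size_zip -sz minnn => ic.
rewrite nth_zip // (nth_map x) // next_cons_nth // nth_rcons.
by case: ifPn => // ci; rewrite if_same [nth x c i]nth_default // leqNgt.
Qed.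

Lemma next_neq_prev c x : 2 < size c -> uniq c -> x \in c ->
  next c x != prev c x.
Proof.
move=> szc uc cx; apply/eqP => eq_np.
have: next c (next c x) = x by rewrite eq_np next_prev.
have [i c' E] := rot_to cx; have := rot_uniq i c; rewrite uc.
rewrite -!(next_rot i uc) E -(size_rot i) E in szc *.
case: c' {E} szc => [|y [|z c']] //= _.
rewrite !inE !negb_or => /andP[/andP[/negPf xy /andP[xz _]] _].
by rewrite eqxx eq_sym xy eqxx => zx; rewrite zx eqxx in xz.
Qed.

End Sequences.

Section InducedSubgraphs.

Variable G : sgraph.
Implicit Types (w x y z : G) (p q c : seq G) (Z : seq (G * G)).

Lemma adj_neq x y : adj x y -> x != y.
Proof. by apply: contraTneq => ->; rewrite adj_irrefl. Qed.

Lemma mem_edges x y : ([set x; y] \in edges G) = adj x y.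
Proof.
apply/imsetP/idP => [[[u v]]|xy]; last by exists (x, y); rewrite ?inE.
by rewrite inE /= => uv /set2_inj[] [-> ->] //; rewrite adj_sym.
Qed.

Lemma induced_by_pairsP (V : {set G}) Z :
  {in Z, forall u, [/\ u.1 \in V, u.2 \in V & adj u.1 u.2]} ->
  is_induced_subgraph (Subgraph V [set [set u.1; u.2] | u in Z]) (whole G) <->
  {in V &, forall x y, adj x y -> (x, y) \in Z \/ (y, x) \in Z}.
Proof.
move=> Zok; split=> [[_ /= eE] x y Vx Vy xy | Zadj].
  have: [set x; y] \in [set e in edges G | e \subset V].
    by rewrite inE mem_edges xy subUset !sub1set Vx Vy.
  rewrite -eE => /imsetP[[u v] /= Zuv] /set2_inj[] [-> ->]; auto.
split=> /=; first exact: subsetT.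
apply/setP=> e; rewrite inE; apply/imsetP/andP => [[u Zu ->] | []].
  by have [V1 V2 adj12] := Zok u Zu; rewrite mem_edges subUset !sub1set V1 V2.
case/imsetP=> [[x y]]; rewrite inE /= => xy ->.
rewrite subUset !sub1set => /andP[Vx Vy].
by have [Zxy|Zyx] := Zadj x y Vx Vy xy;
  [exists (x, y) | exists (y, x) => //=; rewrite setUC].
Qed.

Definition apart x y := (x != y) && ~~ adj x y.

Lemma apart_sym : symmetric apart.
Proof. by move=> x y; rewrite /apart eq_sym adj_sym. Qed.

Fixpoint chordless p : bool :=
  if p is x :: q then
    (if q is y :: r then adj x y && all (apart x) r else true) && chordless q
  else true.

Lemma chordless_cons2 x y p :
  chordless [:: x, y & p] = [&& adj x y, all (apart x) p & chordless (y :: p)].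
Proof. by rewrite andbA. Qed.

Lemma chordlessP x0 p :
  reflect (forall i j, i < j < size p ->
             if j == i.+1 then adj (nth x0 p i) (nth x0 p j)
             else apart (nth x0 p i) (nth x0 p j))
          (chordless p).
Proof.
elim: p => [|x [|y p] IHp]; first by constructor=> i j; rewrite andbF.
  by constructor=> i [|j] //; rewrite ltnS andbF.
rewrite chordless_cons2.
apply: (iffP and3P) => [[xy /(all_nthP x0) x_p /IHp yp] [|i] [|[|j]] //= ij|pP].
- exact: x_p.
- exact: (yp i j.+1).
split; first exact: (pP 0 1).
  by apply/(all_nthP x0) => i ip; apply: (pP 0 i.+2).
by apply/IHp=> i j ij; apply: (pP i.+1 j.+1).
Qed.

Lemma chordless_nth_adj x0 p i j : chordless p -> i < j < size p ->
  adj (nth x0 p i) (nth x0 p j) = (j == i.+1).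
Proof.
by move/(chordlessP x0) => pP /pP; case: eqP => // _ /andP[_ /negbTE].
Qed.

Lemma chordless_uniq p : chordless p -> uniq p.
Proof.
case: p => // x0 p /(chordlessP x0) pP; apply/(uniqP x0) => i j.
wlog lt_ij: i j / i < j => [IH|] ip jp eq_ij.
  by have [/IH->|/IH->|] := ltngtP i j.
have := pP i j; rewrite lt_ij [j < _]jp eq_ij; case: eqP => _ /(_ isT).
  by rewrite adj_irrefl.
by rewrite /apart eqxx.
Qed.

Lemma chordless_sorted p : chordless p -> sorted (@adj G) p.
Proof.
case: p => // x p; elim: p x => // y p IHp x.
by rewrite chordless_cons2 => /and3P[xy _ /IHp yp]; rewrite /= xy.
Qed.

(* A walk [x; y; x] shows that three vertices are not enough. *)
Lemma nth_adj_chordless x0 p : 3 < size p ->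
  (forall i j, i < j < size p ->
     adj (nth x0 p i) (nth x0 p j) = (j == i.+1)) ->
  chordless p.
Proof.
move=> p3 pP; apply/(chordlessP x0) => i j /andP[ij jp].
rewrite /apart pP ?ij //; case: eqP => //= ji; rewrite andbT.
apply/eqP=> eq_ij.
have [jp'|jp'] := boolP (j.+1 < size p).
  have := pP j j.+1; have := pP i j.+1; rewrite eq_ij eqxx; lia.
have := pP i i.+1; have := pP i.+1 j; rewrite -eq_ij adj_sym eqxx => ? ?.
have := pP i.-1 i; have := pP i.-1 j; rewrite -eq_ij; lia.
Qed.

Lemma chordless_rev p : chordless p -> chordless (rev p).
Proof.
case: p => // x0 p /(chordlessP x0) pP; apply/(chordlessP x0) => i j.
rewrite size_rev => /andP[ij jp]; have ip := ltn_trans ij jp.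
rewrite !nth_rev // adj_sym apart_sym.
have := pP (size (x0 :: p) - j.+1) (size (x0 :: p) - i.+1).
have -> : (size (x0 :: p) - i.+1 == (size (x0 :: p) - j.+1).+1) = (j == i.+1).
  by lia.
by apply; lia.
Qed.

Lemma zip_behead_adj p : sorted (@adj G) p ->
  {in zip p (behead p), forall u,
    [/\ u.1 \in [set x in p], u.2 \in [set x in p] & adj u.1 u.2]}.
Proof.
case: p => // x0 p sp [x y] /(mem_zip_beheadP x0)[i ip [-> ->]].
split; rewrite ?inE /=; last exact: (sortedP x0 sp).
  exact: (mem_nth x0 (ltnW ip)).
exact: (mem_nth x0 ip).
Qed.

Lemma induced_pathP l p : is_induced_path l p <-> size p = l.+1 /\ chordless p.
Proof.
case: p => [|x0 p]; first by split=> [[]|[]] [].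
move: (x0 :: p) => {}p; split=> [[[szp up sp] ind] | [szp cp]].
  split=> //; apply/(chordlessP x0) => i j /andP[ij jp].
  have ip := ltn_trans ij jp; have [ji|ji] := eqVneq j i.+1.
    by rewrite ji; apply: (sortedP x0 sp); rewrite -ji.
  have /(induced_by_pairsP (zip_behead_adj sp)) pP := ind.
  rewrite /apart nth_uniq // neq_ltn ij /=; apply/negP=> xij.
  have inV k : k < size p -> nth x0 p k \in [set x in p].
    by move=> kp; rewrite inE mem_nth.
  by have [] := pP _ _ (inV i ip) (inV j jp) xij;
    move=> /(mem_zip_beheadP x0)[k kp [/eqP + /eqP]];
    rewrite !nth_uniq ?(ltnW kp) //; lia.
have sp := chordless_sorted cp.
split; first by split=> //; apply: chordless_uniq.
apply/(induced_by_pairsP (zip_behead_adj sp)) => x y.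
rewrite !inE => /(nthP x0)[i ip <-] /(nthP x0)[j jp <-].
have [ij|ij|->] := ltngtP i j; last by rewrite adj_irrefl.
  rewrite (chordless_nth_adj x0 cp) ?ij // => /eqP ji.
  by left; apply/(mem_zip_beheadP x0); exists i; rewrite -?ji.
rewrite adj_sym (chordless_nth_adj x0 cp) ?ij // => /eqP ji.
by right; apply/(mem_zip_beheadP x0); exists j; rewrite -?ji.
Qed.

Lemma zip_rot1_adj c : uniq c -> cycle (@adj G) c ->
  {in zip c (rot 1 c), forall u,
    [/\ u.1 \in [set x in c], u.2 \in [set x in c] & adj u.1 u.2]}.
Proof.
move=> uc cc u; rewrite zip_rot1 // => /mapP[x cx ->].
by rewrite !inE mem_next cx (next_cycle cc).
Qed.

Lemma induced_cycleP c : is_cycle c ->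
  is_induced_cycle c <->
  {in c &, forall x y, adj x y -> y = next c x \/ x = next c y}.
Proof.
move=> cycc; have [_ uc cc] := cycc.
have zipP x y : x \in c -> (x, y) \in zip c (rot 1 c) <-> y = next c x.
  move=> cx; rewrite zip_rot1 //.
  by split=> [/mapP[z _ [-> ->]] | ->] //; apply: map_f.
have indP := induced_by_pairsP (zip_rot1_adj uc cc).
split=> [[_ /indP ind] x y cx cy xy | nbr_next].
  have [||/zipP->|/zipP->] := ind x y _ _ xy; rewrite ?inE //; auto.
split=> //; apply/indP=> x y; rewrite !inE => cx cy /(nbr_next x y cx cy).
by case=> /zipP; auto.
Qed.

Lemma chordless_cycle w x p y : chordless (x :: rcons p y) ->
  adj w x -> adj w y -> all (apart w) p ->
  is_induced_cycle [:: w, x & rcons p y].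
Proof.
set q := x :: rcons p y => cq wx wy w_p.
have uwq : uniq (w :: q).
  rewrite cons_uniq (chordless_uniq cq) andbT in_cons mem_rcons in_cons.
  rewrite !negb_or (adj_neq wx) (adj_neq wy) /=.
  by apply/negP=> /(allP w_p); rewrite /apart eqxx.
apply/induced_cycleP => [|u v].
  split=> //; first by rewrite /= size_rcons.
  rewrite /= wx rcons_path last_rcons adj_sym wy andbT.
  exact: chordless_sorted cq.
have nbr_w z : z \in q -> adj w z -> z = next (w :: q) w \/ w = next (w :: q) z.
  rewrite in_cons mem_rcons in_cons.
  case/or3P=> [/eqP->|/eqP->|/(allP w_p)/andP[_ /negP]] //.
    by rewrite /= eqxx; left.
  have yE : nth w (w :: q) (size q) = y.
    by rewrite (nth_last w (w :: q)) /= last_rcons.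
  by right; rewrite -yE next_cons_nth // nth_default.
rewrite [u \in _]in_cons [v \in _]in_cons => /orP[/eqP->|qu] /orP[/eqP->|qv].
- by rewrite adj_irrefl.
- exact: nbr_w.
- by rewrite adj_sym => /(nbr_w u qu)[]; auto.
move: qu qv => /(nthP w)[i iq <-] /(nthP w)[j jq <-].
have next_q k : k < size q -> next (w :: q) (nth w q k) = nth w q k.+1.
  exact: (next_cons_nth (i := k.+1) uwq).
have [ij|ij|->] := ltngtP i j; last by rewrite adj_irrefl.
  by rewrite (chordless_nth_adj w cq) ?ij // => /eqP->; left; rewrite next_q.
rewrite adj_sym (chordless_nth_adj w cq) ?ij // => /eqP->.
by right; rewrite next_q.
Qed.

Lemma chordless_prepend x s y : x \notin rcons s y ->
    chordless (rcons s y) -> has (adj x) (rcons s y) ->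
  exists2 q, chordless (x :: rcons q y) & {subset q <= s}.
Proof.
elim: s => [|z s IHs].
  by move=> _ _ /=; rewrite orbF => xy; exists [::]; rewrite //= xy.
rewrite rcons_cons in_cons negb_or => /andP[xz xs] czs /=.
have cs : chordless (rcons s y) by move: czs; case: (s) => //= ? ? /andP[].
have [/(IHs xs cs)[q cq sq] _|/hasPn x_s] := boolP (has _ (rcons s y)).
  by exists q => // u /sq; rewrite in_cons orbC => ->.
have x_apart : all (apart x) (rcons s y).
  by apply/allP=> u su; rewrite /apart x_s // andbT; apply: contraNneq xs => ->.
rewrite orbF => x_adj_z; exists (z :: s); last by [].
by rewrite rcons_cons x_adj_z x_apart.
Qed.

Lemma uniq_path_chordless x p y : uniq (x :: rcons p y) ->
    path (@adj G) x (rcons p y) ->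
  exists2 q, chordless (x :: rcons q y) & {subset q <= p}.
Proof.
elim: p x => [|z p IHp] x.
  by move=> _ /andP[xy _]; exists [::]; rewrite //= xy.
rewrite rcons_cons cons_uniq => /andP[xNp uzp] /andP[xz /(IHp z uzp)[q cq sq]].
have sub_zq : {subset z :: q <= z :: p}.
  by move=> u; rewrite !in_cons => /predU1P[->|/sq->]; rewrite ?eqxx ?orbT.
have [|||r cr sr] := @chordless_prepend x (z :: q) y => //.
- rewrite mem_rcons in_cons; apply: contra xNp.
  rewrite -rcons_cons mem_rcons in_cons.
  by case/orP=> [->//|/sub_zq->]; rewrite orbT.
- by rewrite /= xz.
by exists r => // u /sr/sub_zq.
Qed.

Lemma path_chordless x p y : x != y -> path (@adj G) x p -> last x p = y ->
  exists2 q, chordless (x :: rcons q y) & {subset q <= p}.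
Proof.
move=> + xp lp; case/shortenP: xp lp => p' xp' up' sub_p' <-.
case/lastP: p' xp' up' sub_p' => [|s z]; first by rewrite eqxx.
rewrite last_rcons => xs us sub_p _.
have [q cq sq] := uniq_path_chordless us xs.
by exists q => // u /sq su; apply: sub_p; rewrite mem_rcons in_cons su orbT.
Qed.

End InducedSubgraphs.

(** * Components and automorphisms *)

Section Permutations.

Variables (T : finType) (s : {perm T}).
Implicit Types (A B : {set T}) (e : rel T).

Lemma eq_imset_perm A B : (forall x, (s x \in A) = (x \in B)) -> A = s @: B.
Proof.
move=> sAB; apply/setP=> y; rewrite -(permKV s y) sAB mem_imset //.
exact: perm_inj.
Qed.

Lemma connect_mono_perm e e' : {mono s : x y / e x y >-> e' x y} ->
  {mono s : x y / connect e x y >-> connect e' x y}.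
Proof.
have homo (t : {perm T}) (r r' : rel T) : {homo t : x y / r x y >-> r' x y} ->
    {homo t : x y / connect r x y >-> connect r' x y}.
  move=> tr x _ /connectP[p xp ->]; apply/connectP; exists (map t p).
    exact: homo_path xp.
  by rewrite last_map.
move=> see' x y; apply/idP/idP; last by apply: homo => u v; rewrite see'.
rewrite -{2}(permK s x) -{2}(permK s y); apply: homo => u v.
by rewrite -{1}(permKV s u) -{1}(permKV s v) see'.
Qed.

End Permutations.

Section Components.

Variable G : sgraph.
Implicit Types (x y z : G) (e A B : {set G}) (k : nat).

Definition nbhd x := [set y | adj x y].

Definition degree x := #|nbhd x|.

(* The vertices of [G - N[e]]. *)
Definition far e := [set z | [forall x in e, apart x z]].

Definition restr A : rel G := [rel x y | [&& x \in A, y \in A & adj x y]].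

Definition component A x := [set y | connect (restr A) x y].

Definition large_part A k := [set z in A | k < #|component A z|].

Lemma in_far2 x y z : (z \in far [set x; y]) = apart x z && apart y z.
Proof.
rewrite inE; apply/forall_inP/andP => [z_far | [xz yz] u].
  by rewrite !z_far ?set21 ?set22.
by rewrite !inE => /orP[]/eqP->.
Qed.

Lemma restr_sym A : symmetric (restr A).
Proof. by move=> x y; rewrite /restr /= adj_sym; do !bool_congr. Qed.

Lemma component_refl A x : x \in component A x.
Proof. by rewrite inE. Qed.

Lemma component_eq A x y : y \in component A x -> component A x = component A y.
Proof.
rewrite inE => xy; apply/setP=> z; rewrite !inE.
exact: same_connect (sym_connect_sym (restr_sym A)) _ _ xy _.
Qed.

Lemma component_sub A x : x \in A -> component A x \subset A.
Proof.
move=> Ax; apply/subsetP=> y; rewrite inE => /closed_connect <- // u v.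
by case/and3P=> -> ->.
Qed.

Lemma component_closed A x y z :
  y \in component A x -> restr A y z -> z \in component A x.
Proof. by rewrite !inE => xy yz; apply: connect_trans xy (connect1 yz). Qed.

Lemma componentS A B x :
  component A x \subset B -> component A x \subset component B x.
Proof.
move=> sAB; apply/subsetP=> y; rewrite inE => xy.
pose C := component A x :&: component B x.
suff: y \in C by case/setIP.
rewrite -(closed_connect _ xy) ?inE ?connect0 // {y xy}.
apply: intro_closed => [|u v uv /setIP[Au Bu]].
  exact/sym_connect_sym/restr_sym.
have Av := component_closed Au uv.
rewrite inE Av (component_closed Bu) //.
by have /and3P[_ _ adj_uv] := uv; apply/and3P; split; rewrite // (subsetP sAB).
Qed.

Section Equivariance.

Variable s : {perm G}.
Hypothesis s_aut : is_automorphism s.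

Lemma nbhd_aut x : nbhd (s x) = s @: nbhd x.
Proof. by apply: eq_imset_perm => y; rewrite !inE s_aut. Qed.

Lemma degree_aut x : degree (s x) = degree x.
Proof. by rewrite /degree nbhd_aut card_imset //; apply: perm_inj. Qed.

Lemma far_aut e : far (s @: e) = s @: far e.
Proof.
have apart_aut x y : apart (s x) (s y) = apart x y.
  by rewrite /apart (inj_eq perm_inj) s_aut.
apply: eq_imset_perm => z; rewrite !inE.
apply/forall_inP/forall_inP => [z_far x xe|z_far _ /imsetP[x xe ->]].
  by rewrite -apart_aut z_far ?imset_f.
by rewrite apart_aut z_far.
Qed.

Lemma component_aut A x : component (s @: A) (s x) = s @: component A x.
Proof.
apply: eq_imset_perm => y; rewrite !inE; apply: connect_mono_perm => u v.
by rewrite /restr /= s_aut !mem_imset //; apply: perm_inj.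
Qed.

Lemma large_part_aut A k : large_part (s @: A) k = s @: large_part A k.
Proof.
apply: eq_imset_perm => z; rewrite inE component_aut card_imset ?[RHS]inE.
  by rewrite mem_imset //; apply: perm_inj.
exact: perm_inj.
Qed.

End Equivariance.

Lemma edge_transitive_invariant (rT : Type) (F : {set G} -> rT) x y x' y' :
    edge_transitive G ->
    (forall s e, is_automorphism s -> F (s @: e) = F e) ->
  adj x y -> adj x' y' -> F [set x; y] = F [set x'; y'].
Proof.
move=> et F_aut xy xy'.
by have [|| s /F_aut Fs <-] := et [set x; y] [set x'; y'];
  rewrite ?mem_edges ?Fs.
Qed.

Lemma card_large_part_far x y x' y' k : edge_transitive G ->
    adj x y -> adj x' y' ->
  #|large_part (far [set x; y]) k| = #|large_part (far [set x'; y']) k|.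
Proof.
pose F e := #|large_part (far e) k|.
move=> et; apply: (edge_transitive_invariant (F := F)) et _ => s e s_aut.
by rewrite /F far_aut // large_part_aut // card_imset //; apply: perm_inj.
Qed.

Lemma degree_sum_edge x y x' y' : edge_transitive G -> adj x y -> adj x' y' ->
  degree x + degree y = degree x' + degree y'.
Proof.
move=> et xy xy'; have sumE u v : adj u v ->
    degree u + degree v = \sum_(z in [set u; v]) degree z.
  by move=> /adj_neq uv; rewrite big_setU1 ?big_set1 ?inE.
rewrite !sumE //.
pose F e := \sum_(z in e) degree z.
apply: (edge_transitive_invariant (F := F)) => // s e s_aut.
rewrite /F big_imset => [|u v _ _]; last exact: perm_inj.
by apply: eq_bigr => z _; apply: degree_aut.
Qed.

End Components.

(** * Induced paths of length 3 *)

Section ClosingPaths.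

Variable G : sgraph.
Implicit Types (x y z : G) (p c : seq G) (A B : {set G}).

Definition on_induced_cycle p :=
  exists2 c, is_induced_cycle c & {subset p <= c}.

Lemma on_induced_cycle_closes l p :
  is_induced_path l p -> on_induced_cycle p -> closes_to_induced_cycle p.
Proof.
case=> _ [_ /= Ep] [c cc pc]; exists c => //; have [_ [_ /= Ec]] := cc.
have sub_pc : [set x in p] \subset [set x in c].
  by apply/subsetP=> x; rewrite !inE => /pc.
split=> //=; rewrite Ep Ec; apply/setP=> e; rewrite !inE -andbA; congr (_ && _).
by apply/idP/andP=> [ep|[]//]; split=> //; apply: subset_trans ep sub_pc.
Qed.

Definition attached x A := [exists y in A, adj x y].

Lemma attached_chordless_path A x y z : x != y ->
    attached x (component A z) -> attached y (component A z) ->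
  exists2 p, chordless (x :: rcons p y) & {subset p <= component A z}.
Proof.
move=> xy /exists_inP[u zu xu] /exists_inP[v zv yv].
have /connectP[r ur vE] : connect (restr A) u v.
  by move: zv; rewrite (component_eq zu) inE.
have [||q cq sq] := @path_chordless G x (rcons (u :: r) y) y xy.
- rewrite rcons_path /= xu -vE adj_sym yv andbT.
  by apply: sub_path ur => a b /and3P[].
- by rewrite last_rcons.
exists q => // a qa; have ay : a != y.
  have := chordless_uniq cq; rewrite cons_uniq rcons_uniq => /and3P[_ yNq _].
  by apply: contraNneq yNq => <-.
have := sq a qa; rewrite mem_rcons in_cons (negPf ay) => ra.
by rewrite (component_eq zu) inE; apply: path_connect ur a ra.
Qed.

Definition attached_size e x :=
  \max_(z in far e | attached x (component (far e) z)) #|component (far e) z|.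

Lemma chordless4E x0 x1 x2 x3 : chordless [:: x0; x1; x2; x3] =
  [&& adj x0 x1, adj x1 x2, adj x2 x3, apart x0 x2, apart x0 x3 & apart x1 x3].
Proof.
rewrite /= !andbT; case: (adj x1 x2) (adj x2 x3) => [] [];
  by rewrite ?andbT ?andbF -?andbA.
Qed.

Section InducedPathOfLength3.

Variables x0 x1 x2 x3 : G.
Hypothesis path03 : chordless [:: x0; x1; x2; x3].

Let e := [set x1; x2].
Let f := [set x2; x3].

Lemma attached_both_on_induced_cycle z : z \in far e ->
  attached x0 (component (far e) z) -> attached x3 (component (far e) z) ->
  on_induced_cycle [:: x0; x1; x2; x3].
Proof.
have := path03; rewrite chordless4E.
case/and5P=> adj01 adj12 adj23 apart02 /andP[apart03 apart13].
move=> fz att0 att3; have x30 : x3 != x0 by case/andP: apart03; rewrite eq_sym.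
have [p cp sub_p] := attached_chordless_path x30 att3 att0.
have p_far u : u \in p -> apart x1 u && apart x2 u.
  by move/sub_p/(subsetP (component_sub fz)); rewrite in_far2.
exists (x1 :: x2 :: rcons (x3 :: p) x0); last first.
  move=> u; rewrite !(inE, mem_rcons).
  by case/or4P=> ->; rewrite ?orbT.
apply: chordless_cycle => //.
- rewrite rcons_cons chordless_cons2 adj23 cp all_rcons apart_sym apart02 andbT.
  by apply/allP=> u /p_far/andP[].
- by rewrite adj_sym.
by rewrite /= apart13; apply/allP=> u /p_far/andP[].
Qed.

Lemma start_in_far : x0 \in far f.
Proof.
have := path03; rewrite chordless4E => /and5P[_ _ _ apart02 /andP[apart03 _]].
by rewrite in_far2 ![apart _ x0]apart_sym apart02.
Qed.

Lemma start_notin_far : x0 \notin far e.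
Proof.
have := path03; rewrite chordless4E => /andP[adj01 _].
by rewrite in_far2 /apart [adj x1 _]adj_sym adj01 andbF.
Qed.

Lemma unattached_component_far z : z \in far e ->
  ~~ attached x3 (component (far e) z) -> component (far e) z \subset far f.
Proof.
have := path03; rewrite chordless4E => /and3P[_ _ /andP[adj23 _]].
move=> fz /exists_inPn Nx3; apply/subsetP=> y zy.
have := subsetP (component_sub fz) y zy; rewrite !in_far2 => /andP[_ x2y].
rewrite x2y /apart Nx3 // andbT eq_sym; case/andP: x2y => _.
by apply: contraNneq => ->.
Qed.

Lemma large_part_proper k :
    {in far e, forall z, k < #|component (far e) z| ->
      ~~ attached x3 (component (far e) z)} ->
    k < #|component (far f) x0| ->
  large_part (far e) k \proper large_part (far f) k.
Proof.
move=> large_x3 lt_k; apply/properP; split; last first.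
  by exists x0; rewrite inE ?start_in_far ?(negPf start_notin_far).
apply/subsetP=> z; rewrite inE => /andP[fz kz].
have sub := unattached_component_far fz (large_x3 z fz kz).
rewrite inE (subsetP sub _ (component_refl _ _)).
exact: leq_trans kz (subset_leq_card (componentS sub)).
Qed.

Lemma leq_component_attached_size : edge_transitive G ->
  #|component (far f) x0| <= attached_size e x3.
Proof.
have := path03; rewrite chordless4E => /and3P[_ adj12 /andP[adj23 _]].
move=> et; rewrite leqNgt; apply/negP=> lt_size.
have := card_large_part_far (attached_size e x3) et adj12 adj23.
apply/eqP; rewrite neq_ltn proper_card // large_part_proper // => z fz.
by apply: contraTN => att; rewrite -leqNgt leq_bigmax_cond // fz.
Qed.

Lemma attached_size_ltn_component :
    {in far e, forall z, attached x0 (component (far e) z) ->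
       ~~ attached x3 (component (far e) z)} ->
  attached_size e x0 < #|component (far f) x0|.
Proof.
move=> unattached3; have x0_comp : 0 < #|component (far f) x0|.
  by apply/card_gt0P; exists x0; apply: component_refl.
rewrite -(prednK x0_comp) ltnS; apply/bigmax_leqP=> z /andP[fz att0].
rewrite -ltnS (prednK x0_comp).
have sub := unattached_component_far fz (unattached3 z fz att0).
have /exists_inP[y zy x0y] := att0.
have x0z : x0 \in component (far f) z.
  apply: component_closed (subsetP (componentS sub) y zy) _.
  by rewrite /restr /= start_in_far (subsetP sub _ zy) adj_sym.
rewrite -(component_eq x0z); apply/proper_card/properP.
split; first exact: componentS.
by exists x0 => //; apply: contra start_notin_far; apply/subsetP/component_sub.
Qed.

End InducedPathOfLength3.

Lemma induced_path3_on_induced_cycle x0 x1 x2 x3 : edge_transitive G ->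
  chordless [:: x0; x1; x2; x3] -> on_induced_cycle [:: x0; x1; x2; x3].
Proof.
move=> et p03; pose K := component (far [set x1; x2]).
have [/exists_inP[z fz /andP[]]|/exists_inPn Nboth] :=
  boolP [exists z in far [set x1; x2], attached x0 (K z) && attached x3 (K z)].
  exact: attached_both_on_induced_cycle.
have lt03 : attached_size [set x1; x2] x0 < attached_size [set x1; x2] x3.
  apply: leq_trans (leq_component_attached_size p03 et).
  apply: attached_size_ltn_component p03 _ => z fz att0.
  by have := Nboth z fz; rewrite att0.
have p30 : chordless [:: x3; x2; x1; x0] := chordless_rev p03.
have: attached_size [set x1; x2] x3 < attached_size [set x1; x2] x0.
  rewrite setUC; apply: leq_trans (leq_component_attached_size p30 et).
  apply: attached_size_ltn_component p30 _ => z.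
  rewrite [[set x2; x1]]setUC => fz att3.
  by have := Nboth z fz; rewrite att3 andbT.
by rewrite ltnNge ltnW.
Qed.

End ClosingPaths.

(** * Shorter induced paths *)

Section ShortPaths.

Variable G : sgraph.
Implicit Types (c w x y z : G) (p q : seq G) (A : {set G}).

Lemma connected_closed A x : connected G -> x \in A ->
  (forall y z, adj y z -> y \in A -> z \in A) -> forall y, y \in A.
Proof.
case=> _ conn Ax A_closed y; rewrite -(closed_connect _ (conn x y)) //.
by apply: intro_closed; first exact/sym_connect_sym/adj_sym.
Qed.

Lemma star_with_center c : (forall x, x != c -> adj c x) ->
  (forall x y, x != c -> y != c -> ~~ adj x y) -> is_star G.
Proof.
move=> c_adj leaves; exists #|[set~ c]|.
pose g (u : complete_bipartite 1 #|[set~ c]|) : G :=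
  if u is inr i then enum_val i else c.
have g_leaf (i : 'I_#|[set~ c]|) : enum_val i != c.
  by have := enum_valP i; rewrite in_setC1.
have g_adj u v : adj (g u) (g v) = adj u v.
  case: u v => [i|i] [j|j] /=; rewrite ?adj_irrefl //.
  - exact: c_adj.
  - by rewrite adj_sym c_adj.
  exact/negbTE/leaves.
have g_inj : injective g.
  move=> [i|i] [j|j] /= eq_g.
  - by rewrite (ord1 i) (ord1 j).
  - by have := g_leaf j; rewrite -eq_g eqxx.
  - by have := g_leaf i; rewrite eq_g eqxx.
  by rewrite (enum_val_inj eq_g).
have [|f gK fK] := inj_card_bij g_inj.
  rewrite card_sum !card_ord cardsC1 add1n prednK //.
  by apply/card_gt0P; exists c.
by exists f; [exists g | move=> x y; rewrite -g_adj !fK].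
Qed.

Lemma star_of_leaves c : connected G ->
  (forall y z, adj c y -> adj y z -> z = c) -> is_star G.
Proof.
move=> conn leaf; have c_adj y : y != c -> adj c y.
  have: y \in c |: nbhd c.
    apply: (connected_closed conn (setU11 _ _)) => u v uv; rewrite !inE.
    case/predU1P=> [<-|/leaf/(_ uv)->]; last by rewrite eqxx.
    by rewrite uv orbT.
  by rewrite !inE => /predU1P[->|//]; rewrite eqxx.
apply: (star_with_center c_adj) => x y xc yc.
by apply: contra yc => /(leaf x y (c_adj x xc))->.
Qed.

Lemma on_induced_cycleS p q : {subset p <= q} ->
  on_induced_cycle q -> on_induced_cycle p.
Proof. by move=> pq [c cc qc]; exists c => // x /pq/qc. Qed.

Lemma extends_or_on_induced_cycle w x p y :
    chordless (x :: rcons p y) -> adj w x -> all (apart w) p -> w != y ->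
  chordless [:: w, x & rcons p y] \/ on_induced_cycle (x :: rcons p y).
Proof.
move=> cp wx w_p wy; have [w_adj_y|w_nadj_y] := boolP (adj w y); [right | left].
  exists [:: w, x & rcons p y]; first exact: chordless_cycle.
  by move=> u up; rewrite in_cons up orbT.
by rewrite chordless_cons2 wx cp all_rcons w_p /apart wy w_nadj_y.
Qed.

Lemma degree_ltn_dominated x y t : adj x y -> adj y t -> apart x t ->
  (forall z, adj x z -> z != y -> adj y z) -> degree x < degree y.
Proof.
move=> xy yt /andP[xt x_nadj_t] dom.
have -> : degree x = #|x |: nbhd x :\ y|.
  by rewrite [LHS](cardsD1 y) cardsU1 !inE xy adj_irrefl andbF.
apply/proper_card/properP; split; last first.
  by exists t; rewrite !inE // eq_sym (negPf xt) (negPf x_nadj_t) andbF.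
apply/subsetP=> z; rewrite !inE => /predU1P[->|/andP[zy xz]].
  by rewrite adj_sym.
exact: dom.
Qed.

Hypothesis et : edge_transitive G.

(* A vertex of degree 1 forces the other neighbours of its neighbour to have the
   same degree, since the degree sum is the same for all edges. *)
Lemma degree_le1_star x : connected G -> degree x <= 1 -> is_star G.
Proof.
move=> conn x_le1.
have [/existsP[c xc]|/existsPn x_isolated] := boolP [exists c, adj x c].
  apply: (star_of_leaves (c := c)) => // y z cy yz.
  have := degree_sum_edge et xc cy; rewrite addnC => /addnI eq_deg.
  have /card_le1_eqP y_le1 : degree y <= 1 by rewrite -eq_deg.
  by apply: y_le1; rewrite inE // adj_sym.
apply: (star_of_leaves (c := x)) => // y z xy.
by have := x_isolated y; rewrite xy.
Qed.

Hypothesis (conn : connected G) (Nstar : ~ is_star G).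

Lemma exists_neighbor_neq x y : exists2 z, adj x z & z != y.
Proof.
have x_gt1 : 1 < degree x.
  by rewrite ltnNge; apply/negP=> /(degree_le1_star conn).
have /card_gt0P[z] : 0 < #|nbhd x :\ y|.
  by move: x_gt1; rewrite /degree (cardsD1 y); case: (y \in _) => // /ltnW.
by rewrite !inE => /andP[zy xz]; exists z.
Qed.

Lemma induced_path2_on_induced_cycle x0 x1 x2 :
  chordless [:: x0; x1; x2] -> on_induced_cycle [:: x0; x1; x2].
Proof.
move=> p02; have /and3P[/andP[adj01 /andP[apart02 _]] /andP[adj12 _] _] := p02.
have [/existsP[w /andP[x0w apart1w]]|/existsPn x0_dom] :=
    boolP [exists w, adj x0 w && apart x1 w].
  have [|||p03|//] := @extends_or_on_induced_cycle w x0 [:: x1] x2 p02.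
  - by rewrite adj_sym.
  - by rewrite /= apart_sym apart1w.
  - by case/andP: apart1w => _; apply: contraNneq => ->.
  apply: on_induced_cycleS (induced_path3_on_induced_cycle et p03) => u up.
  by rewrite in_cons up orbT.
have dom z : adj x0 z -> z != x1 -> adj x1 z.
  by move=> x0z zx1; have := x0_dom z; rewrite x0z /apart eq_sym zx1 negbK.
have lt_deg := degree_ltn_dominated adj01 adj12 apart02 dom.
have [z x0z zx1] := exists_neighbor_neq x0 x1.
(* The three edges of the triangle [x0 x1 z] have the same degree sum. *)
have := degree_sum_edge et adj01 x0z.
by have := degree_sum_edge et adj01 (dom z x0z zx1); lia.
Qed.

Lemma edge_on_induced_cycle x y : adj x y -> on_induced_cycle [:: x; y].
Proof.
move=> xy; have [z xz zy] := exists_neighbor_neq x y.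
have [||//|//|p2|//] := @extends_or_on_induced_cycle z x [::] y.
- by rewrite /= xy.
- by rewrite adj_sym.
apply: on_induced_cycleS (induced_path2_on_induced_cycle p2) => u up.
by rewrite in_cons up orbT.
Qed.

Lemma vertex_on_induced_cycle x : on_induced_cycle [:: x].
Proof.
have [z xz _] := exists_neighbor_neq x x.
by apply: on_induced_cycleS (edge_on_induced_cycle xz) => u; rewrite !inE => ->.
Qed.

Lemma short_induced_path_closes l p : l <= 3 -> is_induced_path l p ->
  closes_to_induced_cycle p.
Proof.
move=> l3 ip; apply: on_induced_cycle_closes (ip) _.
have /induced_pathP[szp cp] := ip.
case: p szp cp {ip} => [//|x0 [|x1 [|x2 [|x3 [|x4 p]]]]] szp cp.
- exact: vertex_on_induced_cycle.
- by apply: edge_on_induced_cycle; case/andP: cp => /andP[].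
- exact: induced_path2_on_induced_cycle.
- exact: induced_path3_on_induced_cycle.
by case: szp l3 => <-.
Qed.

End ShortPaths.

(** * Induced paths that do not close *)

Definition has_nonclosing_path (l : nat) (G : sgraph) : Prop :=
  exists p : seq G, is_induced_path l p /\
    forall c : seq G, is_induced_cycle c ->
      ~ is_subgraph (path_subgraph p) (cycle_subgraph c).

Section Obstruction.

Variable G : sgraph.
Implicit Types (w x y : G) (p c : seq G).

Lemma induced_cycle_degree_le2 c y p : is_induced_cycle c -> y \in c ->
  uniq p -> {subset p <= c} -> all (adj y) p -> size p <= 2.
Proof.
move=> ic cy up pc /allP yp; have [cycc _] := ic; have [_ uc _] := cycc.
have /(induced_cycleP cycc) nbr := ic.
apply: (@uniq_leq_size _ p [:: next c y; prev c y]) => // z pz.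
rewrite !inE; have [->|->] := nbr y z cy (pc z pz) (yp z pz).
  by rewrite eqxx.
by rewrite prev_next // eqxx orbT.
Qed.

Lemma cycle_other_neighbor c x y : is_cycle c -> x \in c ->
  exists w, [/\ w \in c, adj x w & w != y].
Proof.
case=> szc uc cc cx; have [<-|ny] := eqVneq (next c x) y.
  exists (prev c x); rewrite mem_prev cx adj_sym (prev_cycle cc) //.
  by rewrite eq_sym next_neq_prev.
by exists (next c x); rewrite mem_next cx (next_cycle cc).
Qed.

Lemma blocked_path_nonclosing x0 l p : size p = l.+1 -> 0 < l -> chordless p ->
    (forall w, adj (nth x0 p 0) w -> w != nth x0 p 1 ->
       exists2 i, 0 < i < l & adj w (nth x0 p i)) ->
  has_nonclosing_path l G.
Proof.
move=> szp l0 cp blocked; exists p; split; first exact/induced_pathP.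
move=> c ic [/= /subsetP sub_pc _]; have [cycc _] := ic.
have pc i : i <= l -> nth x0 p i \in c.
  move=> il; have := sub_pc (nth x0 p i); rewrite !inE; apply.
  by rewrite mem_nth // szp.
have [w [cw x0w wx1]] := cycle_other_neighbor (nth x0 p 1) cycc (pc 0 isT).
have [i /andP[i0 il] wi] := blocked w x0w wx1.
pose a := nth x0 p i.-1; pose b := nth x0 p i.+1.
have w_neq j : j <= l -> w != nth x0 p j.
  move=> jl; apply: contraTneq x0w => wj; move: wx1; rewrite wj.
  case: j {wj} jl => [|j] jl; first by rewrite adj_irrefl.
  by rewrite (chordless_nth_adj x0 cp) ?szp //; apply: contraNN => /eqP->.
have adj_p j k : j < k <= l -> adj (nth x0 p j) (nth x0 p k) = (k == j.+1).
  by move=> jkl; rewrite chordless_nth_adj ?szp.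
have uwab : uniq [:: w; a; b].
  rewrite /= !inE negb_or !w_neq /= ?nth_uniq ?szp ?chordless_uniq; lia.
have sub_c : {subset [:: w; a; b] <= c}.
  by apply/allP; rewrite /= cw !pc //; lia.
suff: all (adj (nth x0 p i)) [:: w; a; b].
  by move/(induced_cycle_degree_le2 ic (pc i (ltnW il)) uwab sub_c).
by rewrite /= adj_sym wi adj_sym !adj_p ?prednK // ?eqxx ?leqnn //; lia.
Qed.

End Obstruction.

(** * Length 4: generalized Paley graphs *)

Section Paley.

Import GRing.Theory.
Local Open Scope ring_scope.

Section GeneralizedPaley.

Variables (F : finFieldType) (k : nat).

(* The exponent is even for the relation to be symmetric. For ['F_13] and
   [k = 2], the sixth roots of unity are the nonzero squares. *)
Definition paley_adj (x y : F) := (x - y) ^+ k.+1.*2 == 1.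

Lemma paley_adj_sym : symmetric paley_adj.
Proof.
by move=> x y; rewrite /paley_adj -opprB exprNn -signr_odd odd_double mul1r.
Qed.

Lemma paley_adj_irrefl : irreflexive paley_adj.
Proof. by move=> x; rewrite /paley_adj subrr expr0n eq_sym oner_eq0. Qed.

Definition paley : sgraph := SGraph paley_adj_sym paley_adj_irrefl.

Lemma paley_edge_transitive : edge_transitive paley.
Proof.
move=> e f /imsetP[[u v]]; rewrite inE /= => uv -> /imsetP[[u' v']].
rewrite inE /= => uv' ->.
pose a := (v' - u') / (v - u).
have a_root : a ^+ k.+1.*2 = 1.
  move: uv uv'; rewrite paley_adj_sym [paley_adj u' _]paley_adj_sym.
  by move=> /eqP uv /eqP uv'; rewrite exprMn exprVn uv uv' invr1 mulr1.
have a0 : a != 0.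
  by apply: contra_eq_neq a_root => ->; rewrite expr0n eq_sym oner_eq0.
have uv0 : v - u != 0.
  by apply: contraNneq a0; rewrite /a => ->; rewrite invr0 mulr0.
have inj_g : injective (fun x : paley => a * (x - u) + u' : paley).
  by move=> x y /addIr/(mulfI a0)/addIr.
exists (perm inj_g) => [x y|].
  rewrite !permE /= /paley_adj opprD addrACA subrr addr0 -mulrBr.
  by rewrite opprB addrA subrK exprMn a_root mul1r.
by rewrite imsetU1 imset_set1 !permE subrr mulr0 add0r divfK ?subrK.
Qed.

End GeneralizedPaley.

Lemma paley_Fp_connected (p k : nat) : connected (paley 'F_p k).
Proof.
split; first by rewrite card_ord.
move=> /= x y; rewrite -[y](subrK x) addrC -[y - x]natr_Zp.
elim: (nat_of_ord _) => [|n IHn]; first by rewrite addr0.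
apply: connect_trans IHn (connect1 _).
rewrite /= /paley_adj -[n.+1]addn1 natrD addrA opprD addrA subrr add0r.
by rewrite -signr_odd odd_double.
Qed.

Lemma paley13_nonclosing : has_nonclosing_path 4 (paley 'F_13 2).
Proof.
pose v i : paley 'F_13 2 := inZp i.
pose p := [seq v i | i <- [:: 0; 1; 2; 6; 7]%N].
apply: (blocked_path_nonclosing (x0 := v 0) (p := p)) => //.
move=> w adj_0w neq_w1.
have: all (fun i => [==> adj (v 0) (v i), v i != v 1 =>
    has (fun j => adj (v i) (nth (v 0) p j)) [:: 1; 2; 3]%N]) (iota 0 13).
  by vm_compute.
move/allP/(_ w); rewrite mem_iota ltn_ord => /(_ isT).
have -> : v w = w by apply: valZpK.
rewrite [adj _ w]adj_0w [w != _]neq_w1 => /hasP[j j123 wj].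
exists j; last exact: wj.
by move: j123 {wj adj_0w neq_w1}; rewrite !inE => /or3P[]/eqP->.
Qed.

End Paley.

(** * Length at least 5: points and 3-subsets *)

Lemma perm_map_uniq (T : finType) (s t : seq T) :
  uniq s -> uniq t -> size s = size t -> exists g : {perm T}, map g s = t.
Proof.
move=> us ut /esym/eqP sz_t; pose tt := Tuple sz_t.
have leT : size s <= #|T| by rewrite -(card_uniqP us) max_card.
have trans_T := ntransitive_weak leT (Sym_trans T).
have [||g _ /(congr1 val) tE] := atransP2 trans_T (x := in_tuple s) (y := tt).
- by rewrite inE us; apply/subsetP.
- by rewrite inE ut; apply/subsetP.
by exists g; rewrite [RHS]tE.
Qed.

Lemma perm_onto_flag (T : finType) (x x' : T) (A A' : {set T}) :
  x \in A -> x' \in A' -> #|A| = #|A'| ->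
  exists2 g : {perm T}, g x = x' & g @: A = A'.
Proof.
have enum1 y (C : {set T}) : y \in C ->
    [/\ uniq (y :: enum (C :\ y)), y :: enum (C :\ y) =i C
       & size (y :: enum (C :\ y)) = #|C|].
  move=> yC; split=> [|z|]; first by rewrite /= enum_uniq mem_enum !inE eqxx.
    by rewrite inE mem_enum in_setD1; case: eqP => // ->.
  by rewrite /= -cardE (cardsD1 y C) yC.
move=> /enum1[us sA sz_s] /enum1[ut tA' sz_t] eqAA'.
have [|g gs] := perm_map_uniq us ut; first by rewrite sz_s sz_t.
exists g; first by case: gs.
apply/setP=> z; rewrite -tA' -gs.
by apply/imsetP/mapP => -[y yA ->]; exists y; rewrite ?sA // -?sA.
Qed.

Section PointsAndSubsets.

Variables (T : finType) (k : nat).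

Definition subset_of_size := {B : {set T} | #|B| == k}.

Implicit Types (x y : T) (A : {set T}) (B : subset_of_size).

Definition incidence_vertex := (T + subset_of_size)%type.

Implicit Types u v : incidence_vertex.

Definition incidence_adj u v :=
  match u, v with
  | inl x, inr B | inr B, inl x => x \in val B
  | _, _ => false
  end.

Lemma incidence_adj_sym : symmetric incidence_adj.
Proof. by case=> [x|B] [y|C]. Qed.

Lemma incidence_adj_irrefl : irreflexive incidence_adj.
Proof. by case. Qed.

Definition incidence_graph : sgraph :=
  SGraph incidence_adj_sym incidence_adj_irrefl.

Lemma perm_subset_subproof (g : {perm T}) B : #|g @: val B| == k.
Proof. by rewrite card_imset; [apply: (valP B) | apply: perm_inj]. Qed.

Definition perm_vertex (g : {perm T}) u : incidence_graph :=
  match u with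
  | inl x => inl (g x)
  | inr B => inr (Sub (g @: val B) (perm_subset_subproof g B))
  end.

Lemma perm_vertex_inj g : injective (perm_vertex g).
Proof.
move=> [x|B] [y|C] //= [] => [/perm_inj->//|/(imset_inj perm_inj)/val_inj->//].
Qed.

Lemma perm_vertex_aut g : is_automorphism (perm (@perm_vertex_inj g)).
Proof.
by move=> [x|B] [y|C]; rewrite !permE //= mem_imset //; apply: perm_inj.
Qed.

Lemma incidence_edge_transitive : edge_transitive incidence_graph.
Proof.
have flag e : e \in edges incidence_graph ->
    exists x B, e = [set inl x; inr B] /\ x \in val B.
  case/imsetP=> [[[x|B] [y|C]]]; rewrite inE //= => xB ->; first by exists x, C.
  by exists y, B; rewrite setUC.
move=> _ _ /flag[x [B [-> xB]]] /flag[x' [B' [-> xB']]].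
have [|g gx gB] := perm_onto_flag xB xB'.
  by rewrite (eqP (valP B)) (eqP (valP B')).
exists (perm (@perm_vertex_inj g)); first exact: perm_vertex_aut.
rewrite imsetU1 imset_set1 !permE /= gx; congr [set _; inr _].
exact: val_inj.
Qed.

Lemma subset_of_size_through x y : x != y -> 1 < k <= #|T| ->
  exists B, (x \in val B) && (y \in val B).
Proof.
move=> xy /andP[k1 kT]; pose s := [:: x, y & enum (~: [set x; y])].
have us : uniq s by rewrite /= !(inE, mem_enum) (negPf xy) !eqxx enum_uniq orbT.
have sz : size s = #|T| by rewrite /= -cardE -(cardsC [set x; y]) cards2 xy.
pose A := [set z in take k s]; have kA : #|A| == k.
  by rewrite cardsE (card_uniqP (take_uniq k us)) size_takel ?sz.
exists (Sub A kA); rewrite SubK !inE /s.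
by case: (k) k1 => [|[|k']] // _; rewrite !inE !eqxx orbT.
Qed.

Lemma incidence_connected : 1 < k <= #|T| -> connected incidence_graph.
Proof.
move=> kT; have csym : connect_sym (@adj incidence_graph).
  exact/sym_connect_sym/adj_sym.
have points x y : connect (@adj incidence_graph) (inl x) (inl y).
  have [->|xy] := eqVneq x y; first exact: connect0.
  have [B /andP[xB yB]] := subset_of_size_through xy kT.
  by apply: connect_trans (connect1 (y := inr B) _) (connect1 _).
have to_point u : exists x, connect (@adj incidence_graph) u (inl x).
  case: u => [x|B]; first by exists x.
  have /card_gt0P[x xB] : 0 < #|val B| by rewrite (eqP (valP B)); lia.
  by exists x; apply: connect1.
split=> [|u v].
  have /card_gt0P[x _] : 0 < #|T| by lia.
  by apply/card_gt0P; exists (inl x).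
have [[x ux] [y vy]] := (to_point u, to_point v).
by apply: connect_trans ux _; rewrite csym; apply: connect_trans vy _.
Qed.

(* The junk value [inl x] is taken when [A] does not have [k] elements. *)
Definition subset_vertex x A : incidence_graph := oapp inr (inl x) (insub A).

Lemma subset_vertexP x A : #|A| = k ->
  exists2 B, subset_vertex x A = inr B & val B = A.
Proof.
by move/eqP=> kA; exists (Sub A kA); rewrite ?SubK // /subset_vertex insubT.
Qed.

Lemma adj_point_subset x y A : #|A| = k ->
  adj (inl y : incidence_graph) (subset_vertex x A) = (y \in A).
Proof. by move/(subset_vertexP x)=> [B -> <-]. Qed.

Lemma adj_subsets x A A' : #|A| = k -> #|A'| = k ->
  adj (subset_vertex x A) (subset_vertex x A') = false.
Proof. by move=> /(subset_vertexP x)[B -> _] /(subset_vertexP x)[B' -> _]. Qed.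

End PointsAndSubsets.

Section LongPath.

Variable n : nat.

(* The third elements are chosen so that the points 0 and 1 of block 0 lie in
   blocks 2 and 1. *)
Definition block i : {set 'I_n.+1} :=
  [set inord i.+1; inord i.+2; inord (i == 1)].

Definition path_vertex j : incidence_graph 'I_n.+1 3 :=
  if odd j then inl (inord j./2.+2) else subset_vertex 3 ord0 (block j./2).

Lemma mem_block a i : a <= n -> i.+2 <= n ->
  (inord a \in block i) = (a \in [:: i.+1; i.+2; nat_of_bool (i == 1)]).
Proof. by move=> an in_; rewrite !inE -!val_eqE /= !inordK ?orbA //; lia. Qed.

Lemma card_block i : i.+2 <= n -> #|block i| = 3.
Proof.
move=> in_; rewrite /block setUC cardsU1 cards2 !inE -!val_eqE /= !inordK;
  lia.
Qed.

Lemma path_vertex_adj i j : i < j -> j./2.+2 <= n ->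
  adj (path_vertex i) (path_vertex j) = (j == i.+1).
Proof.
move=> ij jn; have in_ : i./2.+2 <= n by lia.
have := odd_double_half i; have := odd_double_half j.
rewrite /path_vertex; case: (odd i); case: (odd j) => Ej Ei.
- by apply/esym/negbTE; lia.
- by rewrite adj_point_subset ?card_block // mem_block // !inE; lia.
- by rewrite adj_sym adj_point_subset ?card_block // mem_block // !inE; lia.
by rewrite adj_subsets ?card_block //; apply/esym/negbTE; lia.
Qed.

End LongPath.

Lemma incidence_nonclosing l : 4 < l ->
  has_nonclosing_path l (incidence_graph 'I_l.+1 3).
Proof.
move=> l4; pose p := mkseq (path_vertex l) l.+1; pose x0 := path_vertex l 0.
have bound j : j <= l -> j./2.+2 <= l by lia.
have nth_p j : j <= l -> nth x0 p j = path_vertex l j.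
  by move=> jl; rewrite nth_mkseq.
have chordless_p : chordless p.
  apply: (nth_adj_chordless (x0 := x0)); rewrite size_mkseq; first by lia.
  by move=> i j /andP[ij jl]; rewrite !nth_p ?path_vertex_adj ?bound //; lia.
apply: (blocked_path_nonclosing (x0 := x0) _ _ chordless_p).
- by rewrite size_mkseq.
- by lia.
move=> w; rewrite !nth_p //; last by lia.
have block3 i : i <= 2 -> #|block l i| = 3 by move=> i2; apply: card_block; lia.
case: w => [z|B]; last first.
  have [C block0 _] := subset_vertexP ord0 (block3 0 isT).
  by rewrite /path_vertex /= block0.
rewrite adj_sym adj_point_subset ?block3 // => z0 z_neq.
have : z \in [:: inord 1; inord 2; inord 0] by move: z0; rewrite !inE orbA.
rewrite !inE => /or3P[]/eqP zE; rewrite zE in z_neq *.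
- exists 2; first by lia.
  by rewrite nth_p ?adj_point_subset ?block3 // ?mem_block ?inE //; lia.
- by rewrite eqxx in z_neq.
exists 4; first by lia.
by rewrite nth_p ?adj_point_subset ?block3 // ?mem_block ?inE //; lia.
Qed.

Theorem theorem1p9 :
  (forall G : sgraph, connected G -> edge_transitive G -> ~ is_star G ->
     forall (l : nat) (p : seq G), l <= 3 -> is_induced_path l p ->
       closes_to_induced_cycle p)
  /\
  (forall l : nat, 4 <= l ->
     exists G : sgraph, [/\ connected G, edge_transitive G &
       exists p : seq G, is_induced_path l p /\
         forall c : seq G, is_induced_cycle c ->
           ~ is_subgraph (path_subgraph p) (cycle_subgraph c)]).
Proof.
split=> [G conn et Nstar l p|l l4]; first exact: short_induced_path_closes.
have [<-|l_neq4] := eqVneq 4 l.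
  exists (paley 'F_13 2); split; last exact: paley13_nonclosing.
    exact: paley_Fp_connected.
  exact: paley_edge_transitive.
exists (incidence_graph 'I_l.+1 3); split.
- by apply: incidence_connected; rewrite card_ord; lia.
- exact: incidence_edge_transitive.
by apply: incidence_nonclosing; lia.
Qed.
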